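(* Let $p=p(n)$ satisfy $\frac1n\ll p\le1$, and consider majority bootstrap percolation on $G_{n,p}$ with $A(0)=A_0(n)$ initially active vertices and final active set of size $A^*$. (i) If $A(0)=o(n)$ is monotonically increasing in $n$, then $A^*=o_{\mathrm p}(n)$. More precisely, $$\begin{cases}A^*=A(0)(1+o_{\mathrm p}(1)) & \text{if } A(0)\gg n\exp\left(-\tfrac13np\right),\\[2pt] A^*=O_{\mathrm p}\left(n\exp\left(-\tfrac13np\right)\right) & \text{if } A(0)\le Kn\exp\left(-\tfrac13np\right)\text{ for some constant }K>0.\end{cases}$$ (ii) If $A(0)=\theta n$ with a constant $0<\theta<\frac12$, then $A^*=A(0)(1+o_{\mathrm p}(1))$. (iii) If $$\lim_{n\to\infty}\frac{A(0)-\frac12n}{\sqrt{n/p}}=+\infty,$$ then $A^*=n-o_{\mathrm p}(n)$.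
   Context: $G_{n,p}$ is the random graph on $V_n=\{1,\dots,n\}$ in which each possible edge is present independently with probability $p=p(n)$. Majority bootstrap percolation: start with a set $\mathcal A(0)\subseteq V_n$ of $A(0)=A_0(n)$ initially active vertices, chosen without reference to the edges of the graph. An inactive vertex $v$ becomes active as soon as its number of active neighbours is at least $\max\left(\tfrac12\deg(v),1\right)$, i.e. it has at least one active neighbour and at least half of its neighbours are active. Active vertices stay active. This is repeated until no more vertices become active; $\mathcal A^*$ is the final active set and $A^*=|\mathcal A^*|$. All limits are as $n\to\infty$. $f\gg g$ means $g=o(f)$; so $p\gg\frac1n$ means $np\to\infty$. $X_n=o_{\mathrm p}(a_n)$ means $X_n/a_n\to0$ in probability; $X_n=O_{\mathrm p}(a_n)$ means that for every $\alpha>0$ there is a constant $C_\alpha$ with $\mathbb P\{|X_n|>C_\alpha a_n\}<\alpha$ for all sufficiently large $n$. The quantity $\theta n$ is understood as rounded to an integer. *)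

(* Defs.v *)
From HB Require Import structures.
From mathcomp Require Import all_boot all_order all_algebra.
From mathcomp Require Import all_classical all_reals all_analysis.

Set Implicit Arguments.
Unset Strict Implicit.
Unset Printing Implicit Defensive.

Import Order.TTheory GRing.Theory Num.Theory.
Import numFieldNormedType.Exports.

Local Open Scope classical_set_scope.
Local Open Scope ring_scope.

Definition edge (n : nat) := {e : {set 'I_n} | #|e| == 2%N}.

Definition graph (n : nat) := {set edge n}.

Section Percolation.
Variable n : nat.
Implicit Types (G : graph n) (S : {set 'I_n}).

Definition nbr G (v : 'I_n) : {set 'I_n} :=
  finset (fun w => [exists e in G, val e == [set v; w]%SET]).

Lemma nbr_sym G v w : (w \in nbr G v) = (v \in nbr G w).
Proof. by rewrite !inE finset.setUC. Qed.

Lemma nbr_irr G v : v \notin nbr G v.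
Proof.
rewrite inE; apply/existsP => -[e /andP[_ /eqP ee]].
by have := valP e; rewrite /= ee finset.setUid cards1.
Qed.

Definition majority G S (v : 'I_n) : bool :=
  let k := #|nbr G v :&: S|%SET in (0 < k)%N && (#|nbr G v| <= 2 * k)%N.

Definition step G S : {set 'I_n} :=
  (S :|: finset (fun v => majority G S v))%SET.

(* [n] parallel rounds suffice: see [final_active_stable]. As activation is
   monotone in the active set, the order of activations is irrelevant. *)
Definition final_active G S : {set 'I_n} := iter n (step G) S.

Lemma final_active_stable G S : step G (final_active G S) = final_active G S.
Proof.
have sub k : iter k (step G) S \subset iter k.+1 (step G) S.
  by rewrite iterS finset.subsetUl.
apply/eqP/negPn/negP => ne.
suff H k : (k <= n.+1 -> k <= #|iter k (step G) S|)%N.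
  by have := leq_trans (H _ (leqnn n.+1)) (max_card _); rewrite card_ord ltnn.
elim: k => // k IH kn; apply: (leq_ltn_trans (IH (ltnW kn))).
apply: proper_card; rewrite finset.properEneq sub andbT.
apply: contra ne => /eqP eqk; rewrite /final_active.
rewrite ltnS in kn.
have fixk m : iter m (step G) (iter k (step G) S) = iter k (step G) S.
  by elim: m => //= m ->; rewrite -iterS -eqk.
have -> : iter n (step G) S = iter (n - k + k) (step G) S by rewrite subnK.
by rewrite iterD fixk -iterS -eqk.
Qed.

End Percolation.

Section Laws.
Variable R : realType.

Definition is_pmf (T : finType) (P : T -> R) : Prop :=
  (forall x, 0 <= P x) /\ \sum_x P x = 1.

Definition prob (T : finType) (P : T -> R) (Q : pred T) : R :=
  \sum_(x | Q x) P x.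

Definition gnp (n : nat) (p : R) (G : graph n) : R :=
  \prod_(e : edge n) (if e \in G then p else 1 - p).

Lemma gnp_pmf n p : 0 <= p <= 1 -> is_pmf (@gnp n p).
Proof.
move=> /andP[p0 p1]; split=> [G|].
  by apply: prodr_ge0 => e _; case: ifP => // _; rewrite subr_ge0.
rewrite -bigA_distr big1 // => e _.
by rewrite [LHS]addrC subrK.
Qed.

(* A sample consists of the graph and of the set of initially active vertices;
   the latter is an arbitrary (possibly deterministic) random set of law [nu],
   independent of the graph. *)
Definition sample (n : nat) : finType := (graph n * {set 'I_n})%type.

Definition sample_law (p : nat -> R) (nu : forall n, {set 'I_n} -> R)
  (n : nat) (w : sample n) : R := gnp (p n) w.1 * nu n w.2.

Lemma sample_law_pmf p nu n : 0 <= p n <= 1 -> is_pmf (nu n) ->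
  is_pmf (@sample_law p nu n).
Proof.
move=> /(gnp_pmf n)[g0 g1] [nu0 nu1]; split=> [w|]; first by rewrite mulr_ge0.
rewrite -g1 -(pair_bigA _ (fun G S => gnp (p n) G * nu n S)) /=.
by under eq_bigr => G _ do rewrite -mulr_sumr nu1 mulr1.
Qed.

Definition final_size (n : nat) (w : sample n) : R :=
  #|final_active w.1 w.2|%:R.

End Laws.

Section InProbability.
Variables (R : realType) (T : nat -> finType) (P : forall n, T n -> R).
Implicit Types (X : forall n, T n -> R) (a : nat -> R).

Definition is_op X a : Prop := forall eps : R, 0 < eps ->
  prob (P (n:=n)) (fun w => eps < `|X n w / a n|) @[n --> \oo] --> (0 : R).

Definition is_Op X a : Prop := forall alpha : R, 0 < alpha ->
  exists C : R, \forall n \near \oo,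
    prob (P (n:=n)) (fun w => C * a n < `|X n w|) < alpha.

(* X = a (1 + o_p(1)), almost surely *)
Definition is_asymp_p X a : Prop := exists xi : forall n, T n -> R,
  is_op xi (fun=> 1) /\
  forall n (w : T n), 0 < P w -> X n w = a n * (1 + xi n w).

End InProbability.

(* Main.v *)
Require Import Defs.
From HB Require Import structures.
From mathcomp Require Import all_boot all_order all_algebra.
From mathcomp Require Import all_classical all_reals all_analysis.
From mathcomp Require Import ring lra zify.

Set Implicit Arguments.
Unset Strict Implicit.
Unset Printing Implicit Defensive.

Import Order.TTheory GRing.Theory Num.Theory.
Import numFieldNormedType.Exports.

Local Open Scope classical_set_scope.
Local Open Scope ring_scope.

(** Every part is a union bound over the sets of vertices that could witness a
    deviation, and every witness has the same shape: a set [U] of vertices and a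
    set [X] disjoint from it such that each vertex of [U] has at most as many
    neighbours in [X] as outside [X].

    If at least [s] vertices are activated, stop the process when exactly [s]
    of them are ([exists_stage]): they form [U], and [X] is the set of vertices
    inactive at that time, since a majority of active neighbours is only gained
    as the active set grows. When the active set stays well below [n / 2], a
    vertex of [U] expects many more neighbours in [X] than outside, and as the
    edges counted by the vertices of [U] are independent up to a double count
    inside [U], the exponential Markov inequality ([prob_outweighed]) bounds the
    probability for a given [U] by [expR (- kap * p) ^+ s], with [kap] of order
    [n]. There are at most [(e * n / s) ^+ s] sets [U], so the total is at most
    [(e * n / s * expR (- kap * p)) ^+ s], and hence at most
    [e * n / s * expR (- kap * p)] ([prob_growth]). For a linear initial set
    below [n / 2] this tends to 0 for [s] proportional to [n], as [n * p] tends
    to infinity. For a sublinear one [kap = 3 / 8 * n] is attained, and since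
    [3 / 8 > 1 / 3] the bound still tends to 0 when [s] is merely of order
    [n * expR (- (n * p / 3))].

    If the initial set exceeds [n / 2], take for [U] the set of the vertices
    that never become active and for [X] the final active set. Now each vertex
    of [U] expects an excess [2 * #|X| - n] times [p] of neighbours in [X], while
    the standard deviation of its degree is of order [Num.sqrt (n * p)]. If
    the initial set exceeds [n / 2] by much more than [Num.sqrt (n / p)], the
    excess is a large multiple of this deviation, so the bound for a given [U]
    of size at least [eps * n] is [expR (- M * n)] with [M] as large as desired,
    which beats the [2 ^ n] choices of [U] ([prob_shortfall]). *)

(** * Finite probability *)

Section FiniteProbability.
Variables (R : realType) (T : finType) (P : T -> R).
Hypothesis Ppmf : is_pmf P.

Lemma prob_ge0 (Q : pred T) : 0 <= prob P Q.
Proof. by apply: sumr_ge0 => x _; apply: Ppmf.1. Qed.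

Lemma prob_le1 (Q : pred T) : prob P Q <= 1.
Proof.
rewrite -Ppmf.2 /prob big_mkcond /=; apply: ler_sum => x _.
by case: ifP => // _; apply: Ppmf.1.
Qed.

Lemma le_prob (Q Q' : pred T) : (forall x, Q x -> Q' x) ->
  prob P Q <= prob P Q'.
Proof.
move=> QQ'; rewrite /prob big_mkcond [leRHS]big_mkcond /=.
apply: ler_sum => x _; have [/QQ' -> //|_] := boolP (Q x).
by case: ifP => // _; apply: Ppmf.1.
Qed.

Lemma prob_markov (Q : pred T) (f : T -> R) :
  (forall x, 0 <= f x) -> (forall x, Q x -> 1 <= f x) ->
  prob P Q <= \sum_x P x * f x.
Proof.
move=> f0 f1; rewrite /prob big_mkcond /=; apply: ler_sum => x _.
have [/f1 fx|_] := boolP (Q x); first by rewrite ler_peMr ?Ppmf.1.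
by rewrite mulr_ge0 ?Ppmf.1.
Qed.

Lemma prob_union (I : finType) (J : pred I) (Q : I -> pred T) (c : R) :
  (forall i, J i -> prob P (Q i) <= c) ->
  prob P (fun x => [exists (i | J i), Q i x]) <= #|J|%:R * c.
Proof.
move=> Qc; apply: (@le_trans _ _ (\sum_(i | J i) prob P (Q i))); last first.
  by rewrite mulr_natl -sumr_const; apply: ler_sum.
rewrite /prob (exchange_big_dep predT) //= big_mkcond /=.
apply: ler_sum => x _; case: ifPn => [/existsP[i /andP[Ji Qix]]|_].
  rewrite (bigD1 i) ?Ji //= lerDl; apply: sumr_ge0 => *; exact: Ppmf.1.
by apply: sumr_ge0 => *; exact: Ppmf.1.
Qed.

End FiniteProbability.

(** The graph is independent of the initial set, so a bound that holds for each
    initial set of positive mass survives averaging over the initial set. *)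
Lemma prob_sample_le (R : realType) (p : nat -> R)
    (nu : forall n, {set 'I_n} -> R) n (Q : pred (sample n)) (c : R) :
  is_pmf (nu n) ->
  (forall S, 0 < nu n S -> prob (gnp (p n)) (fun G => Q (G, S)) <= c) ->
  prob (sample_law p nu (n:=n)) Q <= c.
Proof.
move=> [nu0 nu1] Qc.
have -> : prob (sample_law p nu (n:=n)) Q =
    \sum_S nu n S * prob (gnp (p n)) (fun G => Q (G, S)).
  transitivity (\sum_(G : graph n) \sum_(S : {set 'I_n})
      if Q (G, S) then gnp (p n) G * nu n S else 0).
    rewrite pair_bigA /prob big_mkcond /=.
    by apply: eq_bigr => -[G S] _.
  rewrite exchange_big /=; apply: eq_bigr => S _.
  rewrite mulr_sumr [RHS]big_mkcond /=; apply: eq_bigr => G _.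
  by case: ifP => // _; rewrite mulrC.
apply: (@le_trans _ _ (\sum_S nu n S * c)); last by rewrite -mulr_suml nu1 mul1r.
apply: ler_sum => S _; have := nu0 S; rewrite le_eqVlt => /predU1P[<-|nuS].
  by rewrite !mul0r.
by rewrite ler_pM2l // Qc.
Qed.

(** The standard entropy bound: [s ^ s / s`! <= e ^ s], and ['C(n, s) * s`!]
    counts injections. *)
Lemma bin_le_expR (R : realType) n s : (0 < s)%N ->
  'C(n, s)%:R <= (n%:R / s%:R * expR 1) ^+ s :> R.
Proof.
move=> s0; have sR : 0 < s%:R :> R by rewrite ltr0n.
have fR : 0 < (s`!)%:R :> R by rewrite ltr0n fact_gt0.
have le1 : 'C(n, s)%:R * (s`!)%:R <= n%:R ^+ s :> R.
  rewrite -natrM -natrX ler_nat bin_ffact ffact_prod.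
  rewrite -[X in (_ <= n ^ X)%N](card_ord s) -prod_nat_const.
  by apply: leq_prod => i _; apply: leq_subr.
have le2 : s%:R ^+ s <= (s`!)%:R * expR 1 ^+ s :> R.
  have := expR_ge1Dxn s.-1 (ltW sR); rewrite prednK // -expRM_natl mulr1.
  move=> h; rewrite mulrC -ler_pdivrMr //.
  by apply: le_trans h; rewrite lerDr.
rewrite !exprMn exprVn -(ler_pM2r fR); apply: (le_trans le1).
rewrite -!mulrA ler_peMr ?exprn_ge0 // ler_pdivlMl ?exprn_gt0 // mulr1.
by rewrite mulrC.
Qed.

(** * Exponential moments of edge statistics *)

(** The edges are independent, so the expectation factorises into
    [1 - p + p * x e <= expR (p * (x e - 1))]. *)
Lemma gnp_prod_le (R : realType) n (p : R) (x : edge n -> R) :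
  0 <= p <= 1 -> (forall e, 0 <= x e) ->
  \sum_(G : graph n) gnp p G * \prod_(e in G) x e
    <= expR (p * \sum_e (x e - 1)).
Proof.
move=> /andP[p0 p1] x0.
have -> : \sum_(G : graph n) gnp p G * \prod_(e in G) x e =
    \prod_e (p * x e + (1 - p)).
  rewrite bigA_distr; apply: eq_bigr => G _.
  rewrite /gnp [X in _ * X]big_mkcond -big_split /=; apply: eq_bigr => e _.
  by case: ifP => // _; rewrite mulr1.
rewrite mulr_sumr expR_sum; apply: ler_prod => e _; apply/andP; split.
  by rewrite addr_ge0 ?mulr_ge0 // subr_ge0.
apply: le_trans (expR_ge1Dx _); lra.
Qed.

Section EdgeCounting.
Variables (M : Type) (idx : M) (op : Monoid.com_law idx).
Variables (n : nat) (F : 'I_n -> 'I_n -> M).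

(** Expressions that run over the neighbourhoods of the vertices become
    expressions that run over the edges, which are the independent objects. *)
Lemma big_nbr (G : graph n) :
  \big[op/idx]_v \big[op/idx]_(w in nbr G v) F v w =
  \big[op/idx]_(e in G)
    \big[op/idx]_(d : 'I_n * 'I_n | val e == [set d.1; d.2]%SET) F d.1 d.2.
Proof.
rewrite pair_big_dep (exchange_big_dep
  (fun d : 'I_n * 'I_n => d.2 \in nbr G d.1)) /=; last first.
  by move=> e d eG ed; rewrite inE; apply/existsP; exists e; rewrite eG.
apply: eq_bigr => d; rewrite inE => /existsP[e0 /andP[e0G /eqP e0d]].
rewrite (big_pred1 e0) // => e; rewrite /= -e0d.
by apply/andP/eqP => [[_ /eqP /val_inj] //|->].
Qed.

Lemma big_ends (e : edge n) a b : a != b -> val e = [set a; b]%SET ->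
  \big[op/idx]_(d : 'I_n * 'I_n | val e == [set d.1; d.2]%SET) F d.1 d.2 =
  op (F a b) (F b a).
Proof.
move=> ab ->; rewrite (bigD1 (a, b)) //= (big_pred1 (b, a)) // => -[c d] /=.
rewrite !xpair_eqE; apply/andP/andP => [[/eqP/setP h ncd]|[/eqP -> /eqP ->]].
  have := h a; have := h b; have := h c; have := h d.
  rewrite !inE !eqxx ?orbT /= => /orP[]/eqP hd /orP[]/eqP hc; subst;
    rewrite ?eqxx ?(negPf ab) 1?(eq_sym b a) ?(negPf ab) //= in ncd *.
by rewrite (eq_sym b a) (negPf ab) finset.setUC.
Qed.

End EdgeCounting.

Lemma nbr_setT n (v w : 'I_n) :
  (w \in nbr (finset.setTfor (edge n)) v) = (v != w).
Proof.
have [<-|vw] := eqVneq v w; first by rewrite (negPf (nbr_irr _ _)).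
have c2 : #|[set v; w]%SET| == 2%N by rewrite cards2 vw.
rewrite inE; apply/existsP.
exists (exist (fun e : {set 'I_n} => #|e| == 2%N) _ c2).
by rewrite !inE /= eqxx.
Qed.

(** The exponential Markov inequality with the tilt [lam ^+ (deg_Y - deg_X)]
    summed over [U], where [Y] is the complement of [X]. An edge inside [U] is
    counted from both of its ends, whence the factor [lam ^+ 2]. *)
Lemma prob_outweighed (R : realType) n (p lam : R) (X U : {set 'I_n}) :
  0 <= p <= 1 -> 1 <= lam -> [disjoint U & X]%B ->
  prob (gnp p) (fun G =>
    [forall v in U, #|nbr G v :&: X|%SET <= #|nbr G v :\: X|%SET]%N)
  <= expR (- (p * (#|U|%:R * (#|X|%:R * (1 - lam^-1)
                     - (n%:R - #|X|%:R - #|U|%:R) * (lam - 1)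
                     - #|U|%:R * (lam ^+ 2 - 1) / 2)))).
Proof.
move=> p01 lam1 UX; have p0 : 0 <= p by case/andP: p01.
have lam0 : 0 < lam by apply: lt_le_trans lam1.
have lamV0 : 0 < lam^-1 by rewrite invr_gt0.
have UXF v : v \in U -> v \in X = false by move=> /(disjointFr UX).
pose y (v w : 'I_n) : R :=
  if v \in U then if w \in X then lam^-1 else lam else 1.
have y0 v w : 0 < y v w by rewrite /y; case: ifP => // _; case: ifP.
pose x (e : edge n) : R :=
  \prod_(d : 'I_n * 'I_n | val e == [set d.1; d.2]%SET) y d.1 d.2.
(* The gain [x e - 1] of an edge is charged to its ends in [U]: an edge with
   both ends in [U] gains [lam ^+ 2 - 1], half of which goes to each. *)
pose h (v w : 'I_n) : R :=
  if v \in U then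
    if w \in X then lam^-1 - 1
    else if w \in U then (lam ^+ 2 - 1) / 2 else lam - 1
  else 0.
have xh e : x e - 1 =
    \sum_(d : 'I_n * 'I_n | val e == [set d.1; d.2]%SET) h d.1 d.2.
  have /cards2P[a [b [ab eab]]] := valP e.
  rewrite /x !(big_ends _ _ ab eab) /y /h.
  have [aU|aU] := boolP (a \in U); have [bU|bU] := boolP (b \in U); rewrite /=.
  - by rewrite (UXF a) // (UXF b) //= expr2; field.
  - by case: ifP => _; rewrite mulr1 addr0.
  - by case: ifP => _; rewrite mul1r add0r.
  - by rewrite mulr1 addr0 subrr.
have x0 e : 0 <= x e by apply: prodr_ge0 => d _; apply: ltW.
apply: le_trans (_ : \sum_(G : graph n) gnp p G * \prod_(e in G) x e <= _).
  apply: prob_markov; first exact: gnp_pmf.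
    by move=> G; apply: prodr_ge0.
  move=> G /'forall_implyP XG.
  rewrite -(big_nbr _ y).
  elim/big_ind: _ => // [a b a1 b1|v _]; first by rewrite mulr_ege1.
  rewrite (bigID (mem X)) /=.
  have [vU|vU] := boolP (v \in U); last first.
    by rewrite !big1 ?mulr1 // => w _; rewrite /y (negPf vU).
  rewrite (eq_bigr (fun=> lam^-1)); last by move=> w /andP[_ wX]; rewrite /y vU wX.
  rewrite [X in _ * X](eq_bigr (fun=> lam)); last first.
    by move=> w /andP[_ wX]; rewrite /y vU (negPf wX).
  have E1 : \prod_(i in nbr G v | i \in X) lam^-1 = lam^-1 ^+ #|nbr G v :&: X|%SET.
    by rewrite -prodr_const; apply: eq_bigl => w; rewrite !inE.
  have E2 : \prod_(i in nbr G v | i \notin X) lam = lam ^+ #|nbr G v :\: X|%SET.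
    by rewrite -prodr_const; apply: eq_bigl => w; rewrite !inE andbC.
  rewrite E1 E2 exprVn mulrC ler_pdivlMr ?exprn_gt0 // mul1r.
  by apply: ler_weXn2l => //; apply: XG.
apply: le_trans (gnp_prod_le p01 x0) _; rewrite ler_expR -mulrN.
rewrite ler_wpM2l //.
have -> : \sum_e (x e - 1) =
    \sum_v \sum_(w in nbr (finset.setTfor (edge n)) v) h v w.
  rewrite big_nbr [RHS](eq_bigl xpredT); last by move=> e; rewrite inE.
  by apply: eq_bigr => e _; rewrite xh.
rewrite (bigID (mem U)) /= [X in _ + X]big1 ?addr0; last first.
  by move=> v vU; rewrite big1 // => w _; rewrite /h (negPf vU).
have cXU : (#|X| + #|U| + #|~: (X :|: U)|%SET = n)%N.
  by rewrite -cardsUI finset.setIC (disjoint_setI0 UX) cards0 addn0 cardsC card_ord.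
pose c := #|X|%:R * (lam^-1 - 1) + #|U|%:R * ((lam ^+ 2 - 1) / 2)
    + (n%:R - #|X|%:R - #|U|%:R) * (lam - 1).
apply: (@le_trans _ _ (\sum_(v in U) c)); last first.
  by rewrite sumr_const -mulr_natl /c le_eqVlt; apply/predU1l; ring.
apply: ler_sum => v vU; rewrite /c.
have lam21 : 0 <= (lam ^+ 2 - 1) / 2 by rewrite divr_ge0 // subr_ge0 exprn_ege1.
have -> : n%:R - #|X|%:R - #|U|%:R = #|~: (X :|: U)|%SET%:R :> R.
  by rewrite -[in n%:R]cXU !natrD; ring.
(* Adding the loop at [v] only increases the sum. *)
apply: (@le_trans _ _ (\sum_w h v w)).
  rewrite big_mkcond /=; apply: ler_sum => w _; rewrite nbr_setT.
  by have [<-|//] := eqVneq v w; rewrite /h vU UXF.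
rewrite (bigID (mem X)) /= (bigID (mem U) (fun w => w \notin X)) /= addrA.
rewrite !mulr_natl -!sumr_const le_eqVlt; apply/predU1l.
congr (_ + _ + _).
- by apply: eq_bigr => w wX; rewrite /h vU wX.
- apply: eq_big => [w|w /andP[wX wU]]; last by rewrite /h vU (negPf wX) wU.
  by have [/UXF ->//|] := boolP (w \in U); rewrite andbF.
- apply: eq_big => [w|w /andP[wX wU]]; first by rewrite !inE negb_or.
  by rewrite /h vU (negPf wX) (negPf wU).
Qed.

(** * The spread of activation *)

Section Spread.
Variables (n : nat) (G : graph n).
Implicit Types S T : {set 'I_n}.

Lemma card_nbr S v :
  (#|nbr G v :&: S|%SET + #|nbr G v :\: S|%SET = #|nbr G v|)%N.
Proof. exact: cardsID. Qed.

Lemma majority_homo S T v : S \subset T -> majority G S v -> majority G T v.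
Proof.
move=> ST /andP[k0 dk]; have le : (#|nbr G v :&: S|%SET <= #|nbr G v :&: T|%SET)%N.
  by apply: subset_leq_card; apply: finset.setIS.
by rewrite /majority (leq_trans k0 le) (leq_trans dk) // leq_mul2l le.
Qed.

Lemma step_homo S T : S \subset T -> step G S \subset step G T.
Proof.
move=> ST; apply: finset.setUSS => //.
by apply/fintype.subsetP => v; rewrite !inE; apply: majority_homo.
Qed.

Lemma final_sub_stable S T : S \subset T -> step G T = T ->
  final_active G S \subset T.
Proof.
move=> ST TT; suff: forall k, iter k (step G) S \subset T by apply.
elim=> //= k IH.
by rewrite -TT; apply: step_homo.
Qed.

Lemma final_sup S : S \subset final_active G S.
Proof.
suff: forall k, S \subset iter k (step G) S by apply.
elim=> //= k IH.
exact/(fintype.subset_trans IH)/finset.subsetUl.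
Qed.

(** Activating one vertex at a time, the active set passes through every size
    between the initial one and the final one. *)
Lemma exists_stage S k : (#|S| + k <= #|final_active G S|)%N ->
  exists T, [/\ S \subset T, #|T| = (#|S| + k)%N &
    forall v, v \in (T :\: S)%SET -> majority G T v].
Proof.
elim: k => [_|k IH kn].
  by exists S; split; rewrite ?addn0 // => v; rewrite finset.setDv inE.
have /IH[T [ST cT mT]] : (#|S| + k <= #|final_active G S|)%N by lia.
have /fintype.subsetPn[v] : ~~ (step G T \subset T).
  apply/negP => TT; have /subset_leq_card : final_active G S \subset T.
    apply: final_sub_stable => //; apply/eqP.
    by rewrite finset.eqEsubset TT finset.subsetUl.
  by rewrite cT; lia.
rewrite !inE => /orP[-> //|mv] vT; exists (v |: T)%SET.
have TvT : T \subset (v |: T)%SET by apply: finset.subsetU1.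
split; first exact: fintype.subset_trans ST TvT.
  by rewrite cardsU1 vT cT; lia.
move=> w; rewrite !inE => /andP[wS /orP[/eqP ->|wT]].
  exact: majority_homo mv.
by apply: majority_homo (mT w _); rewrite // !inE wS.
Qed.

End Spread.

(** * Deviation bounds for a fixed initial set *)

(** Each of the [s] vertices activated between size [#|S|] and size [#|S| + s]
    has at most as many neighbours outside the latter active set as inside it.
    There are at most ['C(n, s)] choices of these vertices. As the resulting
    bound is an [s]-th power, and a probability is at most 1, it may be
    replaced by its base. *)
Lemma prob_growth (R : realType) n (p lam kap : R) (S : {set 'I_n}) s :
  0 <= p <= 1 -> 1 <= lam -> (0 < s)%N ->
  kap <= (n%:R - #|S|%:R - s%:R) * (1 - lam^-1)
         - #|S|%:R * (lam - 1) - s%:R * (lam ^+ 2 - 1) / 2 ->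
  prob (gnp p) (fun G => #|S| + s <= #|final_active G S|)%N
    <= n%:R / s%:R * expR (1 - p * kap).
Proof.
move=> p01 lam1 s0 hkap; have p0 : 0 <= p by case/andP: p01.
set r := n%:R / s%:R * expR 1 * expR (- (p * kap)).
have -> : n%:R / s%:R * expR (1 - p * kap) = r by rewrite expRD mulrA.
have r0 : 0 <= r by rewrite /r !mulr_ge0 ?expR_ge0 // divr_ge0.
suff hr : prob (gnp p) (fun G => #|S| + s <= #|final_active G S|)%N <= r ^+ s.
  have [r1|r1] := leP 1 r; first exact: le_trans (prob_le1 (gnp_pmf n p01) _) r1.
  apply: (le_trans hr); rewrite -(prednK s0) exprS ler_piMr //.
  by rewrite exprn_ile1 // ltW.
pose J := [pred U : {set 'I_n} | #|U| == s & [disjoint U & S]%B].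
pose Q (U : {set 'I_n}) (G : graph n) :=
  let X := (~: (S :|: U))%SET in
  [forall v in U, #|nbr G v :&: X|%SET <= #|nbr G v :\: X|%SET]%N.
apply: (@le_trans _ _
    (prob (gnp p) (fun G => [exists (U | J U), Q U G]))).
  apply: le_prob; first exact: gnp_pmf.
  move=> G /exists_stage[T [ST cT mT]].
  apply/existsP; exists (T :\: S)%SET.
  have cTS : #|(T :\: S)%SET| = s by rewrite cardsD (finset.setIidPr ST) cT addKn.
  have SUT : (S :|: T :\: S)%SET = T.
    by rewrite -[in RHS](finset.setID T S) (finset.setIidPr ST).
  rewrite /= cTS eqxx /=; apply/andP; split.
    by rewrite finset.disjoints_subset finset.setDE finset.subsetIr.
  apply/'forall_implyP => v /mT /andP[_]; rewrite SUT -(card_nbr G T).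
  rewrite (finset.setDE _ (~: T)%SET) finset.setCK -finset.setDE.
  by rewrite mul2n -addnn leq_add2l.
have cJ : #|J|%:R <= 'C(n, s)%:R :> R.
  rewrite ler_nat -[in X in (_ <= X)%N](card_ord n) -card_draws.
  by apply: subset_leq_card; apply/fintype.subsetP => U; rewrite !inE => /andP[].
apply: (@le_trans _ _ (#|J|%:R * expR (- (p * kap)) ^+ s)); last first.
  rewrite /r exprMn ler_wpM2r ?exprn_ge0 ?expR_ge0 //.
  exact: le_trans cJ (bin_le_expR _ _ s0).
apply: prob_union; first exact: gnp_pmf.
move=> U /andP[/eqP cU US].
have dU : [disjoint U & (~: (S :|: U))%SET]%B.
  by rewrite finset.disjoints_subset finset.setCK finset.subsetUr.
apply: le_trans (prob_outweighed p01 lam1 dU) _.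
have cX : #|(~: (S :|: U))%SET|%:R = n%:R - #|S|%:R - s%:R :> R.
  have : (#|S| + s + #|~: (S :|: U)|%SET = n)%N.
    rewrite -cU -cardsUI finset.setIC (disjoint_setI0 US) cards0 addn0.
    by rewrite cardsC card_ord.
  by move=> /(congr1 (fun k => k%:R : R)); rewrite !natrD => <-; ring.
rewrite -expRM_natl ler_expR cX cU mulrN lerN2 mulrCA ler_wpM2l //.
rewrite ler_wpM2l //; apply: (le_trans hkap).
by rewrite le_eqVlt; apply/predU1l; ring.
Qed.

(** The inactive vertices that remain at the end have at least as many inactive
    neighbours as active ones; there are at most [2 ^ n <= expR n] sets of
    them. The tilt is [lam = 1 + h]. *)
Lemma prob_shortfall (R : realType) n (p h m M : R) (S : {set 'I_n}) :
  0 <= p <= 1 -> 0 <= h -> 0 <= m -> 0 <= M ->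
  M <= p * (h * (2 * #|S|%:R - n%:R) - h ^+ 2 * n%:R) ->
  prob (gnp p) (fun G => m < n%:R - #|final_active G S|%:R)
    <= expR (n%:R - M * m).
Proof.
move=> p01 h0 m0 M0 hM; have p0 : 0 <= p by case/andP: p01.
pose J := [pred U : {set 'I_n} | (m < #|U|%:R) && [disjoint U & S]%B].
pose Q (U : {set 'I_n}) (G : graph n) :=
  let X := (~: U)%SET in
  [forall v in U, #|nbr G v :&: X|%SET <= #|nbr G v :\: X|%SET]%N.
apply: (@le_trans _ _
    (prob (gnp p) (fun G => [exists (U | J U), Q U G]))).
  apply: le_prob; first exact: gnp_pmf.
  move=> G hm; apply/existsP; exists (~: final_active G S)%SET.
  have cf : #|(~: final_active G S)%SET|%:R = n%:R - #|final_active G S|%:R :> R.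
    have := cardsC (final_active G S); rewrite card_ord.
    by move=> /(congr1 (fun k => k%:R : R)); rewrite natrD => <-; ring.
  rewrite /= cf hm /=; apply/andP; split.
    by rewrite finset.disjoints_subset finset.setCS final_sup.
  apply/'forall_implyP => v; rewrite finset.setCK inE => vf.
  have : ~~ majority G (final_active G S) v.
    apply: contra vf => mv; rewrite -(final_active_stable G S).
    by rewrite !inE mv orbT.
  rewrite /majority -(card_nbr G (final_active G S)); lia.
have cJ : #|J|%:R <= expR n%:R :> R.
  apply: (@le_trans _ _ (2 ^+ n)).
    rewrite -natrX ler_nat -[X in (_ <= 2 ^ X)%N](card_ord n) -cardsT.
    rewrite -card_powerset; apply: subset_leq_card.
    by apply/fintype.subsetP => U _; rewrite powersetE finset.subsetT.
  rewrite -[n%:R]mulr1 expRM_natl lerXn2r ?nnegrE ?expR_ge0 //.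
  by apply: le_trans (expR_ge1Dx _); lra.
rewrite expRD; apply: (@le_trans _ _ (#|J|%:R * expR (- (M * m)))); last first.
  by rewrite ler_wpM2r ?expR_ge0.
apply: prob_union; first exact: gnp_pmf.
move=> U /andP[mU US].
have dU : [disjoint U & (~: U)%SET]%B.
  by rewrite finset.disjoints_subset finset.setCK.
have lam1 : 1 <= 1 + h by rewrite lerDl.
apply: le_trans (prob_outweighed p01 lam1 dU) _.
have cX : #|(~: U)%SET|%:R = n%:R - #|U|%:R :> R.
  have := cardsC U; rewrite card_ord.
  by move=> /(congr1 (fun k => k%:R : R)); rewrite natrD => <-; ring.
have cSU : #|U|%:R + #|S|%:R <= n%:R :> R.
  rewrite -natrD ler_nat -cardsUI (disjoint_setI0 US) cards0 addn0.
  by rewrite -[leqRHS](card_ord n) max_card.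
rewrite ler_expR cX lerN2.
set u : R := #|U|%:R in mU cSU *; set a : R := #|S|%:R in hM cSU *.
have u0 : 0 <= u by rewrite /u.
have nu0 : 0 <= n%:R - u by have : 0 <= a by [rewrite /a]; lra.
apply: (@le_trans _ _ (u * M)); first by rewrite mulrC ler_wpM2r // ltW.
rewrite mulrCA ler_wpM2l //; apply: (le_trans hM); rewrite ler_wpM2l //.
have hV : h - h ^+ 2 <= 1 - (1 + h)^-1.
  have h1 : 0 < 1 + h by lra.
  rewrite -subr_ge0 (_ : _ - _ = h ^+ 3 / (1 + h)); last by field; rewrite gt_eqF.
  by rewrite divr_ge0 ?exprn_ge0 // ltW.
have := ler_wpM2l nu0 hV.
have : h * (2 * a - n%:R) <= h * (n%:R - 2 * u) by rewrite ler_wpM2l //; lra.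
have : 0 <= h ^+ 2 * u by rewrite mulr_ge0 // sqr_ge0.
nra.
Qed.

(** [prob_growth] for a real number [m] of new vertices: more than [m] of them
    means at least [s = truncn m + 1], and [m < s <= m + 1]. *)
Lemma prob_excess (R : realType) n (p lam kap m : R) (S : {set 'I_n}) :
  0 <= p <= 1 -> 1 <= lam -> 0 < m ->
  kap <= (n%:R - #|S|%:R - (m + 1)) * (1 - lam^-1)
         - #|S|%:R * (lam - 1) - (m + 1) * (lam ^+ 2 - 1) / 2 ->
  prob (gnp p) (fun G => m < #|final_active G S|%:R - #|S|%:R)
    <= n%:R / m * expR (1 - p * kap).
Proof.
move=> p01 lam1 m0 hkap; pose s := (Num.truncn m).+1.
have /andP[sm ms] := truncn_itv (ltW m0).
have sm1 : s%:R <= m + 1 by rewrite -natr1 lerD2r.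
have lamV : 0 <= 1 - lam^-1 by rewrite subr_ge0 invf_le1 // (lt_le_trans ltr01).
have lam2 : 0 <= lam ^+ 2 - 1 by rewrite subr_ge0 exprn_ege1.
have hkap' : kap <= (n%:R - #|S|%:R - s%:R) * (1 - lam^-1)
         - #|S|%:R * (lam - 1) - s%:R * (lam ^+ 2 - 1) / 2.
  apply: (le_trans hkap).
  have := ler_wpM2r lamV sm1; have := ler_wpM2r lam2 sm1; lra.
apply: (@le_trans _ _ (n%:R / s%:R * expR (1 - p * kap))); last first.
  rewrite ler_wpM2r ?expR_ge0 // ler_wpM2l // lef_pV2 ?posrE ?ltr0n //.
  exact: ltW.
apply: le_trans (prob_growth p01 lam1 (ltn0Sn _) hkap').
apply: le_prob; first exact: gnp_pmf.
move=> G; have le := subset_leq_card (final_sup G S).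
by rewrite -natrB // -truncn_lt_nat ?(ltW m0) // /s; lia.
Qed.

(** With the tilt [lam = 2] the exponent is at least [3 / 8 * n * p]; it exceeds
    the exponent [n * p / 3] of the threshold by [n * p / 24]. *)
Lemma prob_excess_sparse (R : realType) n (p m : R) (S : {set 'I_n}) :
  0 <= p <= 1 -> 0 < m -> #|S|%:R <= n%:R / 30 :> R -> m + 1 <= n%:R / 30 ->
  prob (gnp p) (fun G => m < #|final_active G S|%:R - #|S|%:R)
    <= n%:R * expR (- (n%:R * p / 3)) / m * expR (1 - n%:R * p / 24).
Proof.
move=> p01 m0 Sn mn.
have lam1 : 1 <= 2 :> R by lra.
apply: le_trans (prob_excess (kap := 3 / 8 * n%:R) p01 lam1 m0 _) _; first lra.
have -> : expR (1 - p * (3 / 8 * n%:R)) =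
    expR (- (n%:R * p / 3)) * expR (1 - n%:R * p / 24).
  by rewrite -expRD; congr expR; field.
by rewrite le_eqVlt; apply/predU1l; ring.
Qed.

(** The tilt [lam = 1 / (2 * theta) > 1] makes the exponent per new vertex,
    [(1 - theta) * (1 - lam^-1) - theta * (lam - 1)] in units of [n * p], equal
    to [c = (1 - 2 * theta) ^+ 2 / 2 > 0]. The choice of [d] keeps the losses
    due to the new vertices and to rounding below half of it. *)
Lemma prob_excess_dense (R : realType) (theta : R) : 0 < theta < 1 / 2 ->
  exists2 c : R, 0 < c & exists2 d : R, 0 < d &
  forall n (p m : R) (S : {set 'I_n}), 0 <= p <= 1 -> 0 < m ->
  #|S|%:R <= theta * n%:R + 1 -> m <= d * n%:R -> 1 <= d * n%:R ->
  prob (gnp p) (fun G => m < #|final_active G S|%:R - #|S|%:R)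
    <= n%:R / m * expR (1 - c * (n%:R * p)).
Proof.
move=> /andP[t0 t2]; pose lam := (2 * theta)^-1.
have lamV : lam^-1 = 2 * theta by rewrite /lam invrK.
have tt0 : 0 < 2 * theta by lra.
have lam1 : 1 < lam by rewrite /lam invf_gt1; lra.
have lam2 : 0 <= lam ^+ 2 - 1 by rewrite subr_ge0 exprn_ege1 // ltW.
pose c := (1 - 2 * theta) ^+ 2 / 2.
have c0 : 0 < c by rewrite /c divr_gt0 ?exprn_gt0; lra.
pose D := 3 * (1 - lam^-1) + (lam - 1) + (lam ^+ 2 - 1).
have D0 : 0 < D by rewrite /D lamV; lra.
exists (c / 2); first lra.
exists (c / 4 / D); first by do 2!(apply: divr_gt0 => //).
move=> n p m S p01 m0 Sn.
rewrite (_ : c / 4 / D * n%:R = c / 4 * n%:R / D); last by ring.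
rewrite !ler_pdivlMr // mul1r => mn n1.
apply: le_trans
  (prob_excess (kap := c / 2 * n%:R) p01 (ltW lam1) m0 _) _; last first.
  by rewrite (_ : p * (c / 2 * n%:R) = c / 2 * (n%:R * p)) //; ring.
have ct : (1 - theta) * (1 - lam^-1) - theta * (lam - 1) = c.
  by rewrite lamV /c /lam; field; rewrite gt_eqF.
have ctn : ((1 - theta) * (1 - lam^-1) - theta * (lam - 1)) * n%:R = c * n%:R.
  by rewrite ct.
have lamV1 : 0 <= 1 - lam^-1 by rewrite lamV; lra.
have dlam : 0 <= lam - lam^-1 by lra.
have hS := ler_wpM2r dlam Sn.
have hm : 0 <= m * (1 - lam^-1) by rewrite mulr_ge0 // ltW.
have hl : 0 <= m * (lam - 1) by rewrite mulr_ge0 ?subr_ge0 ?ltW.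
have hL : 0 <= m * (lam ^+ 2 - 1) by rewrite mulr_ge0 // ltW.
rewrite /D in mn n1.
clear D D0 ct lamV; clearbody c lam.
lra.
Qed.

(** * Limits *)

Section Limits.
Variables (R : realType) (p : nat -> R) (A0 : nat -> nat).
Variable nu : forall n : nat, {set 'I_n} -> R.
Arguments nu : clear implicits.
Hypothesis hp : forall n, 0 <= p n <= 1.
Hypothesis hnp : n%:R * p n @[n --> \oo] --> +oo.
Hypothesis hnu : forall n, is_pmf (nu n).
Hypothesis hA0 : forall n (S : {set 'I_n}), 0 < nu n S -> #|S| = A0 n.

Local Notation P := (sample_law p nu).
Local Notation A := (fun n => (A0 n)%:R : R).
Local Notation b := (fun n => n%:R * expR (- (n%:R * p n / 3)) : R).
Local Notation Astar := (fun n (w : sample n) => final_size R w).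

Lemma near_natr_ge (x : R) : \forall n \near \oo, x <= n%:R.
Proof.
near=> n; have := archi_boundP (normr_ge0 x) => h.
apply: (le_trans (ler_norm x)); apply: (le_trans (ltW h)); rewrite ler_nat.
by near: n; exact: nbhs_infty_ge.
Unshelve. all: by end_near. Qed.

Lemma cvg_exp_np (c d : R) : 0 < d ->
  c * expR (- (d * (n%:R * p n))) @[n --> \oo] --> (0 : R).
Proof.
move=> d0; rewrite -[X in _ --> X](mulr0 c); apply: cvgM; first exact: cvg_cst.
apply: (cvg_comp (fun n => d * (n%:R * p n)) (fun x => expR (- x)) _ (@cvgr_expR R)).
apply/cvgryPge => M; have /cvgryPge/(_ (M / d)) := hnp.
by apply: filterS => n; rewrite ler_pdivrMr // mulrC.
Qed.

Lemma prob_cvg0 (Q : forall n, pred (sample n)) (c d : R) : 0 < d ->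
  (\forall n \near \oo, forall S : {set 'I_n}, #|S| = A0 n ->
     prob (gnp (p n)) (fun G => Q n (G, S))
       <= c * expR (- (d * (n%:R * p n)))) ->
  prob (P (n := n)) (Q n) @[n --> \oo] --> (0 : R).
Proof.
move=> d0 Qn; apply: squeeze_cvgr (cvg_cst 0) (cvg_exp_np c d0).
near=> n; rewrite prob_ge0 /=; last exact: sample_law_pmf.
apply: prob_sample_le => // S /hA0; move: S.
by near: n.
Unshelve. all: by end_near. Qed.

(** The relative error is the excess divided by [A0 n]. If [A0 n = 0], it is
    taken to be 0: the final set is then empty too, since activation needs an
    active neighbour. *)
Lemma asymp_of_excess :
  (forall eps : R, 0 < eps -> exists c d : R, 0 < d /\
    \forall n \near \oo, forall S : {set 'I_n}, #|S| = A0 n ->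
      prob (gnp (p n))
        (fun G => eps * A n < #|final_active G S|%:R - #|S|%:R)
        <= c * expR (- (d * (n%:R * p n)))) ->
  is_asymp_p P Astar A.
Proof.
move=> hex; exists (fun n w => if A0 n == 0%N then 0 else final_size R w / A n - 1).
split=> [eps eps0|n [G S] w0].
  have [c [d [d0 hcd]]] := hex _ eps0; apply: (prob_cvg0 (c := c) d0).
  near=> n => S cS.
  apply: le_trans (_ : _ <= prob (gnp (p n))
    (fun G => eps * A n < #|final_active G S|%:R - #|S|%:R)) _; last first.
    by move: S cS; near: n.
  apply: le_prob => [|G]; first exact: gnp_pmf.
  rewrite divr1; case: ifPn => [_|A00]; first by rewrite normr0 ltNge ltW.
  have A_gt0 : 0 < (A0 n)%:R :> R by rewrite ltr0n lt0n.
  have := subset_leq_card (final_sup G S); rewrite -(ler_nat R) /final_size /= cS.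
  move=> le; rewrite (_ : _ / _ - 1 =
    (#|final_active G S|%:R - (A0 n)%:R) / (A0 n)%:R :> R); last first.
    by rewrite mulrBl divff ?gt_eqF.
  by rewrite ger0_norm ?divr_ge0 ?subr_ge0 ?(ltW A_gt0) // ltr_pdivlMr.
have cS : #|S| = A0 n.
  apply: hA0; have := (hnu n).1 S; rewrite le_eqVlt => /predU1P[nuS0|//].
  by move: w0; rewrite /sample_law /= -nuS0 mulr0 ltxx.
case: ifPn => [/eqP A00|A00]; last first.
  by rewrite addrC subrK mulrC divfK // pnatr_eq0.
rewrite addr0 mulr1 /final_size /= A00.
have S0 : S = finset.set0 by apply/eqP; rewrite -cards_eq0 cS A00.
have /subset_leq_card : final_active G S \subset finset.set0.
  apply: final_sub_stable; first by rewrite S0.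
  apply/finset.setP => v; rewrite !inE; apply/negbTE.
  by rewrite /majority finset.setI0 cards0.
by rewrite cards0 leqn0 => /eqP ->.
Unshelve. all: by end_near. Qed.


(** Sublinear initial sets: any excess [m] of order at least [b] that is small
    compared with [n] is unlikely. *)
Lemma sparse_excess (m : nat -> R) (c : R) : A =o_\oo (fun n => n%:R : R) ->
  (\forall n \near \oo,
     [/\ 0 < m n, m n + 1 <= n%:R / 30 & b n <= c * m n]) ->
  \forall n \near \oo, forall S : {set 'I_n}, #|S| = A0 n ->
    prob (gnp (p n)) (fun G => m n < #|final_active G S|%:R - #|S|%:R)
      <= c * expR 1 * expR (- (1 / 24 * (n%:R * p n))).
Proof.
move=> /eqoP/(_ (1 / 30) ltac:(lra)) oA hm; near=> n => S cS.
have [m0 mn bm] : [/\ 0 < m n, m n + 1 <= n%:R / 30 & b n <= c * m n].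
  by near: n.
have An : (A0 n)%:R <= n%:R / 30 :> R.
  have : `|(A0 n)%:R : R| <= 1 / 30 * `|n%:R : R| by near: n.
  by rewrite !ger0_norm //; lra.
apply: le_trans (prob_excess_sparse (hp n) m0 _ mn) _; first by rewrite cS.
have -> : 1 - n%:R * p n / 24 = 1 + - (1 / 24 * (n%:R * p n)) by field.
rewrite expRD mulrA; do 2!(rewrite ler_wpM2r ?expR_ge0 //).
by rewrite ler_pdivrMr.
Unshelve. all: by end_near. Qed.

Lemma sublinear_final : A =o_\oo (fun n => n%:R : R) ->
  is_op P Astar (fun n => n%:R).
Proof.
move=> oA eps eps0.
(* Half of the allowance is for the initial set, half for the excess; [1 / 60]
   keeps the excess below the bound [n / 30] of [prob_excess_sparse]. *)
pose e : R := Num.min eps (1 / 60) / 2.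
have e0 : 0 < e by rewrite divr_gt0 // lt_min eps0; lra.
have e_eps : 2 * e <= eps by rewrite mulrC divfK // ge_min lexx.
have e120 : 2 * e <= 1 / 60 by rewrite mulrC divfK // ge_min lexx orbT.
have hm : \forall n \near \oo,
     [/\ 0 < e * n%:R, e * n%:R + 1 <= n%:R / 30 & b n <= e^-1 * (e * n%:R)].
  near=> n; have n40 : 40 <= n%:R :> R by near: n; exact: near_natr_ge.
  split; first by rewrite mulr_gt0 //; lra.
    have : (2 * e) * n%:R <= 1 / 60 * n%:R by rewrite ler_wpM2r.
    lra.
  rewrite mulKf ?gt_eqF // ler_piMr // -expR0 ler_expR oppr_le0 divr_ge0 //.
  by rewrite mulr_ge0 //; case/andP: (hp n).
have hex := sparse_excess oA hm.
apply: (prob_cvg0 (c := e^-1 * expR 1) (d := 1 / 24)); first lra.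
near=> n => S cS.
have n1 : 1 <= n%:R :> R by near: n; exact: near_natr_ge.
have An : (A0 n)%:R <= e * n%:R.
  rewrite -[n%:R]ger0_norm // -[(A0 n)%:R]ger0_norm //.
  by near: n; move/eqoP: oA; apply.
apply: le_trans (_ : _ <= prob (gnp (p n))
  (fun G => e * n%:R < #|final_active G S|%:R - #|S|%:R)) _; last first.
  by move: S cS; near: n.
apply: le_prob => [|G]; first exact: gnp_pmf.
rewrite /final_size /= ger0_norm ?divr_ge0 // ltr_pdivlMr ?(lt_le_trans ltr01) // cS.
have : 2 * e * n%:R <= eps * n%:R by rewrite ler_wpM2r.
lra.
Unshelve. all: by end_near. Qed.

Lemma near_b_le (e : R) : 0 < e -> \forall n \near \oo, b n <= e * n%:R.
Proof.
move=> e0; have d0 : 0 < 1 / 3 :> R by lra.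
near=> n; rewrite mulrC ler_wpM2r //.
rewrite (_ : n%:R * p n / 3 = 1 / 3 * (n%:R * p n)); last by field.
rewrite -[leLHS]mul1r; near: n.
exact: cvgr_le _ (cvg_exp_np 1 d0) _ e0.
Unshelve. all: by end_near. Qed.

Lemma near_b_gt0 : \forall n \near \oo, 0 < b n.
Proof.
by near=> n; rewrite mulr_gt0 ?expR_gt0 // ltr0n; near: n; exact: nbhs_infty_gt.
Unshelve. all: by end_near. Qed.

Lemma sublinear_asymp : A =o_\oo (fun n => n%:R : R) -> b =o_\oo A ->
  is_asymp_p P Astar A.
Proof.
move=> oA ob; apply: asymp_of_excess => eps eps0.
exists (eps^-1 * expR 1), (1 / 24); split; first lra.
apply: (sparse_excess (m := fun n => eps * A n)) => //.
have e0 : 0 < (60 * eps)^-1 by rewrite invr_gt0 mulr_gt0.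
near=> n; have n60 : 60 <= n%:R :> R by near: n; exact: near_natr_ge.
have bA : b n <= A n.
  rewrite -[A n]mul1r -[b n]ger0_norm ?mulr_ge0 ?expR_ge0 // -[A n]ger0_norm //.
  by near: n; move/eqoP: ob; apply.
have A_gt0 : 0 < A n by apply: lt_le_trans bA; near: n; exact: near_b_gt0.
split; first by rewrite mulr_gt0.
  have : A n <= (60 * eps)^-1 * n%:R.
    rewrite -[n%:R]ger0_norm // -[A n]ger0_norm //.
    by near: n; move/eqoP: oA; apply.
  rewrite mulrC ler_pdivlMr ?mulr_gt0 // => h; lra.
by rewrite mulKf ?gt_eqF.
Unshelve. all: by end_near. Qed.

Lemma sublinear_Op (K : R) : A =o_\oo (fun n => n%:R : R) ->
  (forall n, A n <= K * b n) -> is_Op P Astar b.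
Proof.
move=> oA AK alpha alpha0; exists (K + 1).
have hm : \forall n \near \oo,
     [/\ 0 < b n, b n + 1 <= n%:R / 30 & b n <= 1 * b n].
  near=> n; have n60 : 60 <= n%:R :> R by near: n; exact: near_natr_ge.
  have : b n <= 1 / 60 * n%:R by near: n; apply: near_b_le; lra.
  split; [by near: n; exact: near_b_gt0| lra|by rewrite mul1r].
have hex := sparse_excess oA hm.
suff: prob (P (n := n)) (fun w => (K + 1) * b n < `|final_size R w|)
    @[n --> \oo] --> (0 : R).
  by move/cvgr_lt; apply.
apply: (prob_cvg0 (c := 1 * expR 1) (d := 1 / 24)); first lra.
near=> n => S cS.
apply: le_trans (_ : _ <= prob (gnp (p n))
  (fun G => b n < #|final_active G S|%:R - #|S|%:R)) _; last first.
  by move: S cS; near: n.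
apply: le_prob => [|G]; first exact: gnp_pmf.
by rewrite /final_size /= ger0_norm // cS; have := AK n; rewrite mulrDl mul1r; lra.
Unshelve. all: by end_near. Qed.

Lemma linear_asymp (theta : R) : 0 < theta < 1 / 2 ->
  (forall n, `|A n - theta * n%:R| < 1) -> is_asymp_p P Astar A.
Proof.
move=> t02 hA; have t0 : 0 < theta by case/andP: t02.
have [c c0 [d d0 hcd]] := prob_excess_dense t02.
apply: asymp_of_excess => eps eps0.
pose e : R := Num.min (eps * theta / 2) d.
have e0 : 0 < e by rewrite lt_min d0 !(mulr_gt0, divr_gt0).
exists (e^-1 * expR 1), c; split => //.
near=> n => S cS.
have n1 : 1 <= n%:R :> R by near: n; exact: near_natr_ge.
have dn : d^-1 <= n%:R by near: n; exact: near_natr_ge.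
have tn : 2 / theta <= n%:R by near: n; exact: near_natr_ge.
have /ltr_normlP[lA uA] := hA n.
have n0 : 0 < n%:R :> R by lra.
have m0 : 0 < e * n%:R by rewrite mulr_gt0.
have eeps : e * n%:R <= eps * A n.
  apply: (@le_trans _ _ (eps * theta / 2 * n%:R)).
    by rewrite ler_wpM2r // ge_min lexx.
  rewrite -!mulrA ler_pM2l //; move: tn; rewrite ler_pdivrMr //.
  by move: lA; rewrite (mulrC _ theta); lra.
apply: le_trans (_ : _ <= prob (gnp (p n))
    (fun G => e * n%:R < #|final_active G S|%:R - #|S|%:R)) _.
  by apply: le_prob => [|G]; [exact: gnp_pmf | exact: le_lt_trans].
apply: le_trans (hcd n (p n) (e * n%:R) S (hp n) m0 _ _ _) _.
- by rewrite cS; lra.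
- by rewrite ler_wpM2r // ge_min lexx orbT.
- by rewrite -ler_pdivrMl // mulr1.
rewrite (_ : n%:R / (e * n%:R) = e^-1); last by field; rewrite !gt_eqF.
by rewrite expRD -[leRHS]mulrA.
Unshelve. all: by end_near. Qed.

(** The tilt [h = k / Num.sqrt (n * p)] makes the linear gain
    [h * (2 * A - n) * p >= 2 * k ^+ 2] at least twice the quadratic loss
    [h ^+ 2 * n * p = k ^+ 2]; then [k ^+ 2 = 2 / eps] beats the number of
    subsets. *)
Lemma supercritical :
  (A n - n%:R / 2) / Num.sqrt (n%:R / p n) @[n --> \oo] --> +oo ->
  is_op P (fun n w => n%:R - Astar n w) (fun n => n%:R).
Proof.
move=> hA eps eps0; pose k : R := Num.sqrt (2 / eps).
have k2 : k ^+ 2 = 2 / eps by rewrite sqr_sqrtr // divr_ge0 // ltW.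
have k0 : 0 <= k by exact: sqrtr_ge0.
apply: (prob_cvg0 (c := 1) (d := 1)) => //.
near=> n => S cS.
have n0 : 0 < n%:R :> R by rewrite ltr0n; near: n; exact: nbhs_infty_gt.
have np0 : 0 < n%:R * p n by near: n; exact: (cvgry_gt _).
have p0 : 0 < p n by move: np0; rewrite pmulr_rgt0.
have kA : k <= (A n - n%:R / 2) / Num.sqrt (n%:R / p n).
  by near: n; exact: (cvgry_ge hA).
pose q := Num.sqrt (n%:R * p n).
have q0 : 0 < q by rewrite sqrtr_gt0.
have q2 : q ^+ 2 = n%:R * p n by rewrite sqr_sqrtr // ltW.
have sq : Num.sqrt (n%:R / p n) = q / p n.
  rewrite (_ : n%:R / p n = (q / p n) ^+ 2).
    by rewrite sqrtr_sqr ger0_norm // divr_ge0 // ltW.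
  by rewrite expr_div_n q2; field; rewrite gt_eqF.
rewrite sq ler_pdivlMr ?divr_gt0 // in kA.
have hM : 2 / eps <= p n * (k / q * (2 * #|S|%:R - n%:R) - (k / q) ^+ 2 * n%:R).
  rewrite cS mulrBr (_ : p n * ((k / q) ^+ 2 * n%:R) = k ^+ 2); last first.
    by rewrite expr_div_n q2; field; rewrite !gt_eqF.
  have kpq : 0 <= p n * (k / q) * 2 by rewrite !mulr_ge0 ?invr_ge0 // ltW.
  have := ler_wpM2l kpq kA.
  rewrite (_ : _ * (k * (q / p n)) = 2 * k ^+ 2); last first.
    by field; rewrite !gt_eqF.
  by rewrite -k2 => h; lra.
apply: le_trans (_ : _ <= prob (gnp (p n))
    (fun G => eps * n%:R < n%:R - #|final_active G S|%:R)) _.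
  apply: le_prob => [|G]; first exact: gnp_pmf.
  rewrite /final_size /= ger0_norm ?ltr_pdivlMr // divr_ge0 // subr_ge0 ler_nat.
  by rewrite -[leqRHS](card_ord n) max_card.
apply: le_trans (prob_shortfall (hp n) _ _ _ hM) _.
- by rewrite divr_ge0 // ltW.
- by rewrite mulr_ge0 // ltW.
- by rewrite divr_ge0 // ltW.
rewrite !mul1r ler_expR mulrA divfK ?gt_eqF //.
have : n%:R * p n <= n%:R by rewrite ler_piMr //; case/andP: (hp n).
lra.
Unshelve. all: by end_near. Qed.

End Limits.

Theorem theorem3p5 (R : realType) (p : nat -> R) (A0 : nat -> nat)
    (nu : forall n, {set 'I_n} -> R)
    (hp : forall n, 0 <= p n <= 1)
    (hnp : n%:R * p n @[n --> \oo] --> +oo)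
    (hnu : forall n, is_pmf (nu n))
    (hA0 : forall n (S : {set 'I_n}), 0 < nu n S -> #|S| = A0 n) :
  let P := sample_law p nu in
  let A n : R := (A0 n)%:R in
  let Astar n (w : sample n) := final_size R w in
  let b n : R := n%:R * expR (- (n%:R * p n / 3)) in
  [/\ {homo A0 : m n / (m <= n)%N} ->
      A =o_\oo (fun n => n%:R : R) ->
      [/\ is_op P Astar (fun n => n%:R),
          b =o_\oo A -> is_asymp_p P Astar A
        & (exists2 K : R, 0 < K & forall n, A n <= K * b n) ->
          is_Op P Astar b],
      forall theta : R, 0 < theta < 1 / 2 ->
      (forall n, `|A n - theta * n%:R| < 1) ->
      is_asymp_p P Astar A
    & (A n - n%:R / 2) / Num.sqrt (n%:R / p n) @[n --> \oo] --> +oo ->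
      is_op P (fun n w => n%:R - Astar n w) (fun n => n%:R)].

Proof.
split=> [_ oA|theta t02 hA|hA].
- split=> [|ob|[K _ AK]].
  + exact: (sublinear_final hp hnp hnu hA0).
  + exact: (sublinear_asymp hp hnp hnu hA0).
  + exact: (sublinear_Op hp hnp hnu hA0 oA AK).
- exact: (linear_asymp hp hnp hnu hA0 t02 hA).
- exact: (supercritical hp hnp hnu hA0 hA).
Qed.
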